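(* For every rational $\varepsilon \ge 0$, the (unconstrained) $\varepsilon$-ETR decision problem and the ETR decision problem are polynomial-time reducible to each other (in the Turing/bit model). In other words, $\varepsilon$-ETR $=$ ETR, where ETR denotes the class of problems polynomial-time reducible to the ETR decision problem.
   Context: The ETR decision problem: given a Boolean formula $F$ built with connectives $\land,\lor,\lnot$ from atoms of the form $p(x)\bowtie p'(x)$, where $p,p'$ are multivariate polynomials with rational coefficients in real variables $x=(x_1,\dots,x_q)$ and $\bowtie\in\{<,\le,=,\ge,>\}$, decide whether $\exists x\in\mathbb{R}^q$ with $F(x)$ true. For $\varepsilon\ge 0$ define relaxed comparison operators: $a<_\varepsilon b$ iff $a<b+\varepsilon$; $a\le_\varepsilon b$ iff $a\le b+\varepsilon$; $a>_\varepsilon b$ iff $a>b-\varepsilon$; $a\ge_\varepsilon b$ iff $a\ge b-\varepsilon$. An $\varepsilon$-ETR formula is a negation-free Boolean formula (connectives $\land,\lor$ only) whose atoms compare multivariate polynomials with rational coefficients using only the operators $<_\varepsilon,\le_\varepsilon,\ge_\varepsilon,>_\varepsilon$ (equalities are not allowed; an equality $a=b$ is expressed as $(a\le_\varepsilon b)\land(b\le_\varepsilon a)$). The (unconstrained) $\varepsilon$-ETR decision problem: given such a formula $F$ over variables $x\in\mathbb{R}^q$, decide whether there exists $x\in\mathbb{R}^q$ satisfying $F$. *)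

(* Defs.v *)
From Corelib Require Import BinNums.
From HB Require Import structures.
From mathcomp Require Import all_boot all_order all_algebra.
From mathcomp Require Import reals.
From mathcomp Require Import mpoly.
Set Implicit Arguments.
Unset Strict Implicit.
Unset Printing Implicit Defensive.
Import Order.TTheory GRing.Theory Num.Theory.

Local Open Scope ring_scope.

(** * Multitape Turing machines *)

Inductive direction := MoveL | MoveN | MoveR.

Inductive tape_id (W : Type) := InTape | OutTape | WorkTape of W.
Arguments InTape {W}.
Arguments OutTape {W}.

(* Deterministic machines from words over A to words over B, with finitely
   many states, tape symbols and work tapes.  A cell holds [None] when blank. *)
Record TM (A B : finType) := MkTM {
  tm_state : finType;
  tm_sym : finType;
  tm_work : finType;
  tm_in : A -> tm_sym;
  tm_in_inj : injective tm_in;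
  tm_out : B -> tm_sym;
  tm_out_inj : injective tm_out;
  tm_start : tm_state;
  tm_halt : pred tm_state;
  tm_trans : tm_state -> (tape_id tm_work -> option tm_sym) ->
             tm_state * (tape_id tm_work -> option tm_sym * direction)
}.

(* A two-way infinite tape, indexed relatively to the head: the scanned cell
   is cell 0. *)
Definition tape (S : Type) := int -> option S.

Definition write_move (S : Type) (t : tape S) (a : option S * direction) :
    tape S :=
  let t' := fun i => if i == 0 then a.1 else t i in
  match a.2 with
  | MoveL => fun i => t' (i - 1)
  | MoveN => t'
  | MoveR => fun i => t' (i + 1)
  end.

Definition blank_tape (S : Type) : tape S := fun _ => None.

(* The word w on an otherwise blank tape, with the head on its first letter. *)
Definition word_tape (S : Type) (w : seq S) : tape S :=
  fun i => if i is Posz n then onth w n else None.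

Section Run.
Variables (A B : finType) (M : TM A B).

Record config := MkConfig {
  cf_state : tm_state M;
  cf_tape : tape_id (tm_work M) -> tape (tm_sym M)
}.

Definition init_config (w : seq A) : config :=
  MkConfig (tm_start M) (fun j =>
    if j is InTape then word_tape (map (@tm_in _ _ M) w)
    else @blank_tape _).

Definition tm_step (c : config) : config :=
  if tm_halt (cf_state c) then c else
  let a := tm_trans (cf_state c) (fun j => cf_tape c j 0) in
  MkConfig a.1 (fun j => write_move (cf_tape c j) (a.2 j)).

Definition outputs_within (w : seq A) (v : seq B) (t : nat) : Prop :=
  let c := iter t tm_step (init_config w) in
  tm_halt (cf_state c) /\
  cf_tape c OutTape =1 word_tape (map (@tm_out _ _ M) v).

End Run.

(** * Decision problems and polynomial-time many-one reductions *)

Record problem := MkProblem {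
  alphabet : finType;
  instance : Type;
  encode : instance -> seq alphabet;
  encode_inj : injective encode;
  yes : instance -> Prop
}.

Definition polytime_computable (P Q : problem) (f : instance P -> instance Q) :
    Prop :=
  exists (M : TM (alphabet P) (alphabet Q)) (c k : nat),
    forall x : instance P,
      outputs_within M (encode x) (encode (f x))
        (c * size (encode x) ^ k + c)%N.

Definition polytime_reducible (P Q : problem) : Prop :=
  exists f : instance P -> instance Q,
    polytime_computable f /\ forall x, yes x <-> yes (f x).

Definition class_of (Q : problem) : problem -> Prop :=
  fun P => polytime_reducible P Q.

(** * Formulas *)

(* The sparse presentation of a polynomial in q variables: a list of terms
   c * x_i1^e1 * ... * x_ik^ek, with repetitions allowed. *)
Definition monom (q : nat) := seq ('I_q * nat).
Definition spoly (q : nat) := seq (rat * monom q).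

Definition mpoly_of (q : nat) (p : spoly q) : {mpoly rat[q]} :=
  \sum_(t <- p) t.1 *: \prod_(v <- t.2) 'X_(v.1) ^+ v.2.

Lemma mpoly_of_surj (q : nat) (P : {mpoly rat[q]}) : exists p, mpoly_of p = P.
Proof.
exists [seq (P@_m, [seq (i, m i) | i <- enum 'I_q]) | m <- msupp P].
rewrite [RHS]mpolyE /mpoly_of big_map; apply: eq_bigr => m _ /=.
by rewrite mpolyXE_id big_map big_enum.
Qed.

Definition spoly_eval (R : realType) (q : nat) (x : 'I_q -> R) (p : spoly q) :
    R :=
  (map_mpoly (@ratr R) (mpoly_of p)).@[x].

Inductive cmp := CLt | CLe | CEq | CGe | CGt.

Definition cmp_holds (R : realType) (r : cmp) (a b : R) : bool :=
  match r with
  | CLt => a < b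
  | CLe => a <= b
  | CEq => a == b
  | CGe => a >= b
  | CGt => a > b
  end.

Inductive formula (q : nat) :=
  | FAtom of cmp & spoly q & spoly q
  | FAnd of formula q & formula q
  | FOr of formula q & formula q
  | FNot of formula q.

Fixpoint holds (R : realType) (q : nat) (x : 'I_q -> R) (F : formula q) :
    Prop :=
  match F with
  | FAtom r p p' => cmp_holds r (spoly_eval x p) (spoly_eval x p')
  | FAnd F1 F2 => holds x F1 /\ holds x F2
  | FOr F1 F2 => holds x F1 \/ holds x F2
  | FNot F1 => ~ holds x F1
  end.

Inductive eps_cmp := LtE | LeE | GeE | GtE.

Definition eps_cmp_holds (R : realType) (eps : R) (r : eps_cmp) (a b : R) :
    bool :=
  match r with
  | LtE => a < b + eps
  | LeE => a <= b + eps
  | GeE => a >= b - eps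
  | GtE => a > b - eps
  end.

Inductive eps_formula (q : nat) :=
  | EAtom of eps_cmp & spoly q & spoly q
  | EAnd of eps_formula q & eps_formula q
  | EOr of eps_formula q & eps_formula q.

Fixpoint eps_holds (R : realType) (eps : R) (q : nat) (x : 'I_q -> R)
    (F : eps_formula q) : Prop :=
  match F with
  | EAtom r p p' => eps_cmp_holds eps r (spoly_eval x p) (spoly_eval x p')
  | EAnd F1 F2 => eps_holds eps x F1 /\ eps_holds eps x F2
  | EOr F1 F2 => eps_holds eps x F1 \/ eps_holds eps x F2
  end.

(** * Encoding of formulas as words *)

Inductive symbol :=
  | SBit0 | SBit1 | SNumEnd | SMinus
  | STimes | SMonEnd | SPlus | SPolyEnd
  | SAnd | SOr | SNot
  | SLt | SLe | SEq | SGe | SGt.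

Definition symbols : seq symbol :=
  [:: SBit0; SBit1; SNumEnd; SMinus; STimes; SMonEnd; SPlus; SPolyEnd;
      SAnd; SOr; SNot; SLt; SLe; SEq; SGe; SGt].

Definition symbol_code (s : symbol) : nat :=
  match s with
  | SBit0 => 0 | SBit1 => 1 | SNumEnd => 2 | SMinus => 3
  | STimes => 4 | SMonEnd => 5 | SPlus => 6 | SPolyEnd => 7
  | SAnd => 8 | SOr => 9 | SNot => 10
  | SLt => 11 | SLe => 12 | SEq => 13 | SGe => 14 | SGt => 15
  end%N.

Lemma symbol_codeK : pcancel symbol_code (onth symbols).
Proof. by case. Qed.

HB.instance Definition _ := Countable.copy symbol (pcan_type symbol_codeK).

Lemma symbols_enum : Finite.axiom symbols.
Proof. by case. Qed.

HB.instance Definition _ := isFinite.Build symbol symbols_enum.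

(* Numbers are written in binary, least significant bit first; 0 has no bits. *)
Fixpoint pos_bits (p : positive) : seq symbol :=
  match p with
  | xH => [:: SBit1]
  | xO p' => SBit0 :: pos_bits p'
  | xI p' => SBit1 :: pos_bits p'
  end.

Definition enc_nat (n : nat) : seq symbol :=
  (if bin_of_nat n is Npos p then pos_bits p else [::]) ++ [:: SNumEnd].

Definition enc_int (z : int) : seq symbol :=
  (if z < 0 then [:: SMinus] else [::]) ++ enc_nat `|z|%N.

Definition enc_rat (c : rat) : seq symbol :=
  enc_int (numq c) ++ enc_nat `|denq c|%N.

Fixpoint enc_seq (T : Type) (item stop : symbol) (enc : T -> seq symbol)
    (s : seq T) : seq symbol :=
  if s is x :: s' then item :: enc x ++ enc_seq item stop enc s'
  else [:: stop].

Definition enc_factor (q : nat) (v : 'I_q * nat) : seq symbol :=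
  enc_nat v.1 ++ enc_nat v.2.

Definition enc_term (q : nat) (t : rat * monom q) : seq symbol :=
  enc_rat t.1 ++ enc_seq STimes SMonEnd (@enc_factor q) t.2.

Definition enc_spoly (q : nat) (p : spoly q) : seq symbol :=
  enc_seq SPlus SPolyEnd (@enc_term q) p.

Definition enc_cmp (r : cmp) : symbol :=
  match r with
  | CLt => SLt | CLe => SLe | CEq => SEq | CGe => SGe | CGt => SGt
  end.

Definition enc_eps_cmp (r : eps_cmp) : symbol :=
  match r with LtE => SLt | LeE => SLe | GeE => SGe | GtE => SGt end.

(* Formulas are written in prefix notation. *)
Fixpoint enc_formula (q : nat) (F : formula q) : seq symbol :=
  match F with
  | FAtom r p p' => enc_cmp r :: enc_spoly p ++ enc_spoly p'
  | FAnd F1 F2 => SAnd :: enc_formula F1 ++ enc_formula F2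
  | FOr F1 F2 => SOr :: enc_formula F1 ++ enc_formula F2
  | FNot F1 => SNot :: enc_formula F1
  end.

Fixpoint enc_eps_formula (q : nat) (F : eps_formula q) : seq symbol :=
  match F with
  | EAtom r p p' => enc_eps_cmp r :: enc_spoly p ++ enc_spoly p'
  | EAnd F1 F2 => SAnd :: enc_eps_formula F1 ++ enc_eps_formula F2
  | EOr F1 F2 => SOr :: enc_eps_formula F1 ++ enc_eps_formula F2
  end.

Definition etr_instance := {q : nat & formula q}.
Definition eps_etr_instance := {q : nat & eps_formula q}.

Definition enc_etr (I : etr_instance) : seq symbol :=
  enc_nat (tag I) ++ enc_formula (tagged I).

Definition enc_eps_etr (I : eps_etr_instance) : seq symbol :=
  enc_nat (tag I) ++ enc_eps_formula (tagged I).

Definition prefix_free (T : Type) (enc : T -> seq symbol) :=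
  forall x y s t, enc x ++ s = enc y ++ t -> x = y /\ s = t.

Lemma prefix_free_inj (T : Type) (enc : T -> seq symbol) :
  prefix_free enc -> injective enc.
Proof. by move=> pf x y exy; case: (pf x y [::] [::]); rewrite ?exy. Qed.

Lemma pos_bits_pf p p' s t :
  pos_bits p ++ SNumEnd :: s = pos_bits p' ++ SNumEnd :: t ->
  p = p' /\ s = t.
Proof.
elim: p p' => [p IH|p IH|] [p'|p'|] //= [].
- by move/IH => [-> ->].
- by case: p {IH}.
- by move/IH => [-> ->].
- by case: p'.
- by move=> ->.
Qed.

Lemma enc_nat_pf : prefix_free enc_nat.
Proof.
move=> m n s t; rewrite /enc_nat -!catA /= => E.
suff [e ->] : bin_of_nat m = bin_of_nat n /\ s = t.
  by split=> //; rewrite -(bin_of_natK m) e bin_of_natK.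
case: (bin_of_nat m) (bin_of_nat n) E => [|p] [|p'] //=.
- by case=> ->.
- by case: p'.
- by case: p.
- by move/pos_bits_pf => [-> ->].
Qed.

Lemma enc_natNminus n s t : enc_nat n ++ s <> SMinus :: t.
Proof. by rewrite /enc_nat; case: (bin_of_nat n) => [|[]]. Qed.

Lemma enc_int_pf : prefix_free enc_int.
Proof.
move=> y z s t; rewrite /enc_int.
case: (ltP y 0) => y0; case: (ltP z 0) => z0;
  rewrite -!(catA _ (enc_nat _)).
- move=> [] /enc_nat_pf [e ->]; split=> //.
  by apply: oppr_inj; rewrite -(ltr0_norm y0) -(ltr0_norm z0) -!abszE e.
- by move/esym/enc_natNminus.
- by move/enc_natNminus.
- move=> /enc_nat_pf [e ->]; split=> //.
  by rewrite -(ger0_norm y0) -(ger0_norm z0) -!abszE e.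
Qed.

Lemma enc_rat_pf : prefix_free enc_rat.
Proof.
move=> x y s t; rewrite /enc_rat -!(catA (enc_int _)).
move=> /enc_int_pf [en /enc_nat_pf [ed ->]].
split=> //; rewrite -(divq_num_den x) -(divq_num_den y) en.
by rewrite -(gtz0_abs (denq_gt0 x)) -(gtz0_abs (denq_gt0 y)) ed.
Qed.

Lemma enc_seq_pf (T : Type) (item stop : symbol) (enc : T -> seq symbol) :
  item <> stop -> prefix_free enc -> prefix_free (enc_seq item stop enc).
Proof.
move=> ne pf; elim=> [|x u IH] [|y v] s t //=.
- by case=> ->.
- by case=> e; case: ne.
- by case=> e; case: ne.
- by rewrite -!catA => -[] /pf [-> /IH [-> ->]].
Qed.

Lemma enc_factor_pf q : prefix_free (@enc_factor q).
Proof.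
move=> [i e] [j f] s t; rewrite /enc_factor -!(catA (enc_nat _)) /=.
by move=> /enc_nat_pf [/val_inj -> /enc_nat_pf [-> ->]].
Qed.

Lemma enc_term_pf q : prefix_free (@enc_term q).
Proof.
move=> [c m] [d n] s t; rewrite /enc_term -!(catA (enc_rat _)) /= => /enc_rat_pf [-> E].
by have [|-> ->] := enc_seq_pf _ (@enc_factor_pf q) E.
Qed.

Lemma enc_spoly_pf q : prefix_free (@enc_spoly q).
Proof. by apply: enc_seq_pf => //; apply: enc_term_pf. Qed.

Lemma enc_formula_pf q : prefix_free (@enc_formula q).
Proof.
elim=> [r p p'|F1 IH1 F2 IH2|F1 IH1 F2 IH2|F1 IH1]
  [r' p1 p1'|G1 G2|G1 G2|G1] s t /=; rewrite -?catA.
all: try by case: r.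
all: try by case: r'.
all: try by [].
- case=> er /enc_spoly_pf [-> /enc_spoly_pf [-> ->]].
  by split=> //; congr FAtom; case: r r' er => [] [].
- by case=> /IH1 [-> /IH2 [-> ->]].
- by case=> /IH1 [-> /IH2 [-> ->]].
- by case=> /IH1 [-> ->].
Qed.

Lemma enc_eps_formula_pf q : prefix_free (@enc_eps_formula q).
Proof.
elim=> [r p p'|F1 IH1 F2 IH2|F1 IH1 F2 IH2]
  [r' p1 p1'|G1 G2|G1 G2] s t /=; rewrite -?catA.
all: try by case: r.
all: try by case: r'.
all: try by [].
- case=> er /enc_spoly_pf [-> /enc_spoly_pf [-> ->]].
  by split=> //; congr EAtom; case: r r' er => [] [].
- by case=> /IH1 [-> /IH2 [-> ->]].
- by case=> /IH1 [-> /IH2 [-> ->]].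
Qed.

Lemma enc_etr_inj : injective enc_etr.
Proof.
move=> [q F] [q' G]; rewrite /enc_etr /= => /enc_nat_pf [e].
by case: q' / e G => G /(prefix_free_inj (@enc_formula_pf q)) ->.
Qed.

Lemma enc_eps_etr_inj : injective enc_eps_etr.
Proof.
move=> [q F] [q' G]; rewrite /enc_eps_etr /= => /enc_nat_pf [e].
by case: q' / e G => G /(prefix_free_inj (@enc_eps_formula_pf q)) ->.
Qed.

(** * The two decision problems *)

Definition ETR (R : realType) : problem :=
  MkProblem enc_etr_inj
    (fun I => exists x : 'I_(tag I) -> R, holds x (tagged I)).

Definition EpsETR (R : realType) (eps : rat) : problem :=
  MkProblem enc_eps_etr_inj
    (fun I => exists x : 'I_(tag I) -> R, eps_holds (ratr eps) x (tagged I)).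

(* Main.v *)
(** With polynomials as operands a relaxed comparison and an exact one differ by
    a rational constant: [a <_eps b] is [a - eps < b], and [a < b] is
    [a + eps <_eps b].  Going from eps-ETR to ETR is therefore a letter-to-word
    substitution, inserting a constant term after each comparison symbol.  The
    converse also has to remove negations and equalities: a machine reads the
    prefix notation while keeping on a stack the polarities of the pending right
    subformulas, and copies each atom twice, [a = b] becoming [a <= b] and
    [a >= b].  Both machines run in linear time, and the equality of the classes
    follows by composing reductions. *)

Require Import Defs.
From HB Require Import structures.
From mathcomp Require Import all_boot all_order all_algebra.
From mathcomp Require Import boolp reals.
From mathcomp Require Import mpoly.
From mathcomp Require Import zify.
Set Implicit Arguments.
Unset Strict Implicit.
Unset Printing Implicit Defensive.
Import Order.TTheory GRing.Theory Num.Theory.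

Local Open Scope ring_scope.

(** * Runs of Turing machines *)

Section Runs.
Variables (A B : finType) (M : TM A B).
Implicit Types c : config M.

Lemma iter_step_halted n c :
  tm_halt (cf_state c) -> iter n (@tm_step _ _ M) c = c.
Proof. by move=> h; elim: n => //= n ->; rewrite /tm_step h. Qed.

Lemma outputs_within_mono w v t t' :
  (t <= t')%N -> outputs_within M w v t -> outputs_within M w v t'.
Proof.
by move=> /subnK <- [h e]; rewrite /outputs_within iterD iter_step_halted.
Qed.

Lemma write_move_support (S : Type) (t : tape S) (a : option S * direction) m :
  (forall i, (m < `|i|)%N -> t i = None) ->
  forall i, (m.+1 < `|i|)%N -> write_move t a i = None.
Proof.
move=> t0 i hi; case: a => x []; rewrite /write_move /=; case: eqP => e;
  by [lia | apply: t0; lia].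
Qed.

(** A step displaces the head by at most one cell and writes only under it, so marks stay within
    distance [m]. The input tape is excluded because it does not start blank. *)
Lemma run_support w j m i : j <> InTape -> (m < `|i|)%N ->
  cf_tape (iter m (@tm_step _ _ M) (init_config M w)) j i = None.
Proof.
move=> nj; elim: m i => [|m IH] i hi; first by case: j nj.
rewrite iterS /tm_step; case: ifP => _ /=; first by apply: IH; lia.
exact: write_move_support IH i hi.
Qed.

(** Cell [t.+1] cannot have been reached. This bounds the intermediate word when two reductions are
    composed. *)
Lemma output_size w v t : outputs_within M w v t -> (size v <= t.+1)%N.
Proof.
case=> _ e; rewrite leqNgt; apply/negP => lt.
have := e (Posz t.+1); rewrite run_support // /word_tape.
by move/esym/(congr1 isSome); rewrite onthTE size_map lt.
Qed.

End Runs.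

(** * Composition of reductions *)

Section Composition.
Variables (A B C : finType) (M1 : TM A B) (M2 : TM B C).

(** The extra [unit] work tape is the output tape of [M1] and afterwards the input tape of [M2]. *)
Let sym := (tm_sym M1 + tm_sym M2)%type.
Let work := ((tm_work M1 + tm_work M2) + unit)%type.

Definition tape1 (j : tape_id (tm_work M1)) : tape_id work :=
  match j with
  | InTape => InTape
  | OutTape => WorkTape (inr tt)
  | WorkTape v => WorkTape (inl (inl v))
  end.

Definition tape2 (j : tape_id (tm_work M2)) : tape_id work :=
  match j with
  | InTape => WorkTape (inr tt)
  | OutTape => OutTape
  | WorkTape v => WorkTape (inl (inr v))
  end.

(* The intermediate tape is left to the second machine in the symbols of the
   first one, which are translated when they are read. *)
Definition read1 (s : option sym) : option (tm_sym M1) :=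
  if s is Some (inl s1) then Some s1 else None.

Definition read2 (s : option sym) : option (tm_sym M2) :=
  match s with
  | Some (inr s2) => Some s2
  | Some (inl s1) => omap (@tm_in _ _ M2) [pick b | tm_out M1 b == s1]
  | None => None
  end.

Definition comp_trans (s : tm_state M1 + tm_state M2)
    (rd : tape_id work -> option sym) :
    (tm_state M1 + tm_state M2) * (tape_id work -> option sym * direction) :=
  match s with
  | inl s1 =>
    if tm_halt s1 then (inr (tm_start M2), fun j => (rd j, MoveN)) else
    let a := tm_trans s1 (fun j => read1 (rd (tape1 j))) in
    let wr j := (omap inl (a.2 j).1, (a.2 j).2) in
    (inl a.1, fun j =>
      match j with
      | InTape => wr InTape
      | OutTape => (rd j, MoveN)
      | WorkTape (inl (inl v)) => wr (WorkTape v)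
      | WorkTape (inl (inr _)) => (rd j, MoveN)
      | WorkTape (inr _) => wr OutTape
      end)
  | inr s2 =>
    let a := tm_trans s2 (fun j => read2 (rd (tape2 j))) in
    let wr j := (omap inr (a.2 j).1, (a.2 j).2) in
    (inr a.1, fun j =>
      match j with
      | InTape => (rd j, MoveN)
      | OutTape => wr OutTape
      | WorkTape (inl (inl _)) => (rd j, MoveN)
      | WorkTape (inl (inr v)) => wr (WorkTape v)
      | WorkTape (inr _) => wr InTape
      end)
  end.

Lemma comp_in_inj : injective (fun a => inl (tm_in M1 a) : sym).
Proof. by move=> x y [] /tm_in_inj. Qed.

Lemma comp_out_inj : injective (fun c => inr (tm_out M2 c) : sym).
Proof. by move=> x y [] /tm_out_inj. Qed.

Definition comp_tm : TM A C :=
  @MkTM A C (tm_state M1 + tm_state M2)%type sym work _ comp_in_inj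
    _ comp_out_inj (inl (tm_start M1))
    (fun s => if s is inr s2 then tm_halt s2 else false) comp_trans.

Definition sim1 (c : config M1) (d : config comp_tm) :=
  [/\ cf_state d = inl (cf_state c),
      forall j i, cf_tape d (tape1 j) i = omap inl (cf_tape c j i),
      forall i, cf_tape d OutTape i = None &
      forall v i, cf_tape d (WorkTape (inl (inr v))) i = None].

(** [read2] identifies different symbols, so the output tape, whose actual symbols matter at the
    end, gets a stricter condition of its own. *)
Definition sim2 (c : config M2) (d : config comp_tm) :=
  [/\ cf_state d = inr (cf_state c),
      forall j i, read2 (cf_tape d (tape2 j) i) = cf_tape c j i &
      forall i, cf_tape d OutTape i = omap inr (cf_tape c OutTape i)].

Lemma write_move_map (S T : Type) (f : option S -> option T)
    (t : tape S) (u : tape T) a b :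
  (forall i, f (t i) = u i) -> f a.1 = b.1 -> a.2 = b.2 ->
  forall i, f (write_move t a i) = write_move u b i.
Proof.
case: a b => x d [y _] tu /= xy <- i.
by case: d; rewrite /write_move /=; case: eqP.
Qed.

Lemma write_move_blank (S : Type) (t : tape S) :
  (forall i, t i = None) -> forall i, write_move t (t 0, MoveN) i = None.
Proof. by move=> t0 i; rewrite /write_move /=; case: eqP. Qed.

Lemma sim1_step c d : ~~ tm_halt (cf_state c) -> sim1 c d ->
  sim1 (tm_step c) (tm_step d).
Proof.
move=> nh [es et e0 ew]; rewrite /tm_step /= es (negPf nh) /= (negPf nh).
have -> : (fun j => read1 (cf_tape d (tape1 j) 0)) = (fun j => cf_tape c j 0).
  by apply: funext => j; rewrite et; case: (cf_tape c j 0).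
split=> //=.
- by move=> j i; apply/esym; case: j => [||v] /=;
    apply: write_move_map => // k; rewrite -(et, et OutTape, et (WorkTape _)).
- exact: write_move_blank.
- by move=> v; apply: write_move_blank.
Qed.

Lemma sim2_step c d : sim2 c d -> sim2 (tm_step c) (tm_step d).
Proof.
move=> [es et eo]; rewrite /tm_step /= es /=; case: ifP => // _ /=.
have -> : (fun j => read2 (cf_tape d (tape2 j) 0)) = (fun j => cf_tape c j 0).
  by apply: funext => j; rewrite et.
split=> //=.
- have r2 (x : option (tm_sym M2)) : read2 (omap inr x) = x by case: x.
  case=> [||v].
  + by apply: (@write_move_map _ _ read2) => //; apply: r2.
  + by apply: (@write_move_map _ _ read2) => //; apply: r2.
  + by apply: (@write_move_map _ _ read2) => //; apply: r2.
- by move=> i; apply/esym; apply: write_move_map => // k; rewrite -eo.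
Qed.

(** A halted [M1] idles while the composite would already hand over, so the simulation is stopped at
    the first halting time [m]. *)
Lemma sim1_run n c d : sim1 c d -> tm_halt (cf_state (iter n (@tm_step _ _ M1) c)) ->
  exists2 m, (m <= n)%N &
    sim1 (iter n (@tm_step _ _ M1) c) (iter m (@tm_step _ _ comp_tm) d).
Proof.
elim: n c d => [|n IH] c d s; first by exists 0%N.
case: (boolP (tm_halt (cf_state c))) => [h _|nh].
  by rewrite iter_step_halted //; exists 0%N.
rewrite !iterSr => /(IH _ _ (sim1_step nh s)) [m le sm].
by exists m.+1; rewrite ?iterSr.
Qed.

Lemma comp_outputs w u v t1 t2 :
  outputs_within M1 w u t1 -> outputs_within M2 u v t2 ->
  outputs_within comp_tm w v (t1 + t2.+1).
Proof.
move=> [h1 o1] [h2 o2].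
have s0 : sim1 (init_config M1 w) (init_config comp_tm w).
  split=> //= -[||v'] //= [n|n] //=.
  by rewrite !onthE -!map_comp; elim: w n {h1 o1} => [|a w IH] [|n] /=.
have [m le [es et e0 ew]] := sim1_run s0 h1.
set d := iter m _ _ in es et e0 ew.
(* The handover step: the output of [M1], translated by [read2], is the input word of [M2], and the
   other tapes of [M2] are still blank. *)
have s1 : sim2 (init_config M2 u) (tm_step d).
  rewrite /tm_step /= es /= h1; split=> //=.
  - move=> -[||v'] i /=.
    + transitivity (read2 (cf_tape d (tape1 OutTape) i)).
        by rewrite /write_move /=; case: eqP => // ->.
      rewrite et o1; case: i => [n|//]; rewrite /word_tape !onthE -!map_comp.
      elim: u n {h2 o1 o2} => [|b u IH] [|n] //=.
      by case: pickP => [b' /eqP/tm_out_inj -> //|/(_ b)]; rewrite eqxx.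
    + by rewrite write_move_blank.
    + by rewrite write_move_blank.
  - by move=> i; rewrite write_move_blank.
have s2 n : sim2 (iter n (@tm_step _ _ M2) (init_config M2 u))
                 (iter n (@tm_step _ _ comp_tm) (tm_step d)).
  by elim: n => // n IH; rewrite !iterS; apply: sim2_step.
apply: (@outputs_within_mono _ _ _ _ _ (t2.+1 + m)%N); first by lia.
have [es2 _ eo2] := s2 t2.
rewrite /outputs_within iterD -/d iterSr; split; first by rewrite /= es2.
move=> i; rewrite eo2 o2; case: i => //= n.
by rewrite !onthE -!map_comp; elim: v n {h2 o2} => [|a v IH] [|n] /=.
Qed.

End Composition.

Lemma polytime_computable_comp (P Q S : problem)
    (f : instance P -> instance Q) (g : instance Q -> instance S) :
  polytime_computable f -> polytime_computable g -> polytime_computable (g \o f).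
Proof.
move=> [M1 [c1 [k1 h1]]] [M2 [c2 [k2 h2]]].
pose D := (c1 + 1)%N.
exists (comp_tm M1 M2), (c1 + c1 + 1 + c2 + 2 * c2 * (D ^ k2 * 2 ^ k2))%N,
  (k1 * k2 + k1)%N => x.
set n := size (encode x).
apply: outputs_within_mono (comp_outputs (h1 x) (h2 (f x))).
have le1 := output_size (h1 x); rewrite -/n in le1 *.
set N := size (encode (f x)) in le1 *.
(* By [output_size], [N] is at most [c1 * n ^ k1 + c1 + 1], hence at most
   [D * 2 * maxn (n ^ k1) 1]. *)
have leN : (N ^ k2 <= D ^ k2 * 2 ^ k2 * (n ^ (k1 * k2) + 1))%N.
  apply: (@leq_trans ((D * (2 * maxn (n ^ k1) 1)) ^ k2)).
    by case: (k2) => // k; rewrite leq_exp2r //; nia.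
  rewrite !expnMn -mulnA !leq_mul2l; apply/orP; right; apply/orP; right.
  rewrite expnM; case: (leqP (n ^ k1) 1) => h; last by rewrite leq_addr.
  by rewrite exp1n addn1.
(* Powers of [n] are compared with the exponent [k1 * k2 + k1]; the added 1 covers [n = 0], where
   [0 ^ 0 = 1] breaks monotonicity. *)
have z m : (0 ^ m <= 1)%N by case: m => // m; rewrite exp0n.
have a1 : (n ^ k1 <= n ^ (k1 * k2 + k1) + 1)%N.
  case: (n) => [|n']; last by apply: leq_trans (leq_addr _ _); rewrite leq_pexp2l // leq_addl.
  exact: leq_trans (z _) (leq_addl _ _).
have a2 : (n ^ (k1 * k2) <= n ^ (k1 * k2 + k1) + 1)%N.
  case: (n) => [|n']; last by apply: leq_trans (leq_addr _ _); rewrite leq_pexp2l // leq_addr.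
  exact: leq_trans (z _) (leq_addl _ _).
move: (D ^ k2 * 2 ^ k2)%N leN a1 a2 => E leN a1 a2.
have b1 := leq_mul (leqnn c1) a1.
have b2 := leq_mul (leqnn c2) (leq_trans leN (leq_mul (leqnn E) (leq_add a2 (leqnn 1)))).
nia.
Qed.

Lemma polytime_reducible_trans (P Q S : problem) :
  polytime_reducible P Q -> polytime_reducible Q S -> polytime_reducible P S.
Proof.
move=> [f [cf ef]] [g [cg eg]]; exists (g \o f); split.
  exact: polytime_computable_comp.
by move=> x; rewrite ef eg.
Qed.

(** * Tapes as pairs of lists *)

Section Tapes.
Variable S : Type.
Implicit Types (l r : seq (option S)) (u v : seq S).

Lemma write_moveE (t : tape S) : write_move t (t 0, MoveN) = t.
Proof. by apply: funext => i; rewrite /write_move /=; case: eqP => [->|]. Qed.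

(* The cells left of the head, nearest first, and the cells from the head on. *)
Definition ztape l r : tape S :=
  fun i => match i with Posz n => nth None r n | Negz n => nth None l n end.

Lemma write_moveN l r a : write_move (ztape l r) (a, MoveN) = ztape l (a :: behead r).
Proof. by apply: funext => -[[|n]|n] //=; rewrite nth_behead. Qed.

Lemma write_moveR l r a : write_move (ztape l r) (a, MoveR) = ztape (a :: l) (behead r).
Proof.
apply: funext => -[n|n]; rewrite /write_move /ztape /=.
  by rewrite -PoszD addn1 /= nth_behead.
case: n => [//|n]; have -> : Negz n.+1 + 1 = Negz n by lia.
by [].
Qed.

Lemma write_moveL l r a :
  write_move (ztape l r) (a, MoveL) = ztape (behead l) (head None l :: a :: behead r).
Proof.
apply: funext => -[n|n]; rewrite /write_move /ztape /=.
  case: n => [|n]; first by case: l.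
  have -> : Posz n.+1 - 1 = Posz n by lia.
  by case: n => //= n; rewrite nth_behead.
by rewrite addn0 nth_behead.
Qed.

Definition wtape u v : tape S := ztape (map Some u) (map Some v).

Lemma word_tapeE v : word_tape v = wtape [::] v.
Proof. by apply: funext => -[n|n]; rewrite /= ?nth_nil // onthE. Qed.

Lemma blank_tapeE : @blank_tape S = wtape [::] [::].
Proof. by apply: funext => -[n|n]; rewrite /= nth_nil. Qed.

Lemma wtapeR u a v : write_move (wtape u (a :: v)) (Some a, MoveR) = wtape (a :: u) v.
Proof. exact: write_moveR. Qed.

Lemma wtapeL a u b v :
  write_move (wtape (a :: u) (b :: v)) (Some b, MoveL) = wtape u (a :: b :: v).
Proof. exact: write_moveL. Qed.

Lemma wtape_push u a : write_move (wtape u [::]) (Some a, MoveR) = wtape (a :: u) [::].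
Proof. exact: write_moveR. Qed.

(** The head rests above the stack, so a pop takes two moves: onto the top letter, then erasing it
    in place. In between, the head scans the top letter with an explicit blank to its right, which
    [wtape] cannot express. *)
Lemma wtape_top a u :
  write_move (wtape (a :: u) [::]) (None, MoveL) = ztape (map Some u) [:: Some a; None].
Proof. exact: write_moveL. Qed.

Lemma wtape_pop a u :
  write_move (ztape (map Some u) [:: Some a; None]) (None, MoveN) = wtape u [::].
Proof.
by rewrite write_moveN; apply: funext => -[[|[|[|n]]]|n].
Qed.

(** A pop from the empty stack meets a blank; this is how the end of a formula is detected. *)
Lemma blank_moveL : write_move (wtape [::] [::]) (None, MoveL) = wtape [::] [::].
Proof. by rewrite write_moveL; apply: funext => -[[|[|[|n]]]|n] /=; rewrite ?nth_nil. Qed.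

End Tapes.

(** * Stack transducers *)

(* A finite control reading a two-way input and a work tape; at each step it
   writes a word of length at most [bound], changes state and acts on both
   tapes.  It stops when [delta] returns [None]. *)
Section Transducer.
Variables (S Q : finType) (bound : nat) (q0 : Q).
Variable delta : Q -> option S -> option S ->
  option (Q * seq S * direction * (option S * direction)).
Hypothesis delta_bound : forall q a g q' w d h,
  delta q a g = Some (q', w, d, h) -> (size w <= bound)%N.

(* [inl (q, w)] still has to write w before acting in state q; [inr false]
   brings the output head back to the first letter; [inr true] is final. *)
Let state := ((Q * {bseq bound of S}) + bool)%type.

Definition td_trans (s : state) (rd : tape_id unit -> option S) :
    state * (tape_id unit -> option S * direction) :=
  let keep j := (rd j, MoveN) in
  let out a := fun j => if j is OutTape then a else keep j in
  match s with
  | inl (q, w) =>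
    if bseqval w is a :: w' then
      (inl (q, insub_bseq bound w'), out (Some a, MoveR))
    else if delta q (rd InTape) (rd (WorkTape tt)) is Some (q', w', d, h) then
      (inl (q', insub_bseq bound w'), fun j =>
        match j with
        | InTape => (rd InTape, d)
        | OutTape => keep OutTape
        | WorkTape _ => h
        end)
    else (inr false, out (rd OutTape, MoveL))
  | inr b =>
    if rd OutTape is Some _ then (inr false, out (rd OutTape, MoveL))
    else (inr true, out (rd OutTape, MoveR))
  end.

Definition td_tm : TM S S :=
  @MkTM S S state S unit id (@inj_id _) id (@inj_id _)
    (inl (q0, insub_bseq bound [::])) (fun s => if s is inr b then b else false)
    td_trans.

Let step := @tm_step _ _ td_tm.

Definition td_config (s : state) (i o w : tape S) : config td_tm :=
  @MkConfig _ _ td_tm s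
    (fun j => match j with InTape => i | OutTape => o | WorkTape _ => w end).

Definition td_state q w : state := inl (q, insub_bseq bound w).

(* The word o has been written and the output head is just behind it. *)
Definition td_at q (i : tape S) (o : seq S) (w : tape S) :=
  td_config (td_state q [::]) i (wtape (rev o) [::]) w.

(** [insub_bseq] falls back to a default on longer words; [delta_bound] rules these out. *)
Lemma val_insub_bseq (w : seq S) : (size w <= bound)%N ->
  bseqval (insub_bseq bound w) = w.
Proof. by move=> h; rewrite /insub_bseq; apply: insubdK. Qed.

Lemma td_write q w i o t : (size w <= bound)%N ->
  iter (size w) step (td_config (td_state q w) i (wtape (rev o) [::]) t) =
  td_at q i (o ++ w) t.
Proof.
elim: w o => [|a w IH] o hw; first by rewrite cats0.
rewrite -[size _]/(size w).+1 iterSr -cat1s catA cats1 -IH ?(ltnW hw) //.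
congr (iter _ _ _); rewrite /step /tm_step /= val_insub_bseq //=.
rewrite /td_config; congr MkConfig; apply: funext => -[||v] /=; rewrite ?write_moveE //.
by rewrite wtape_push rev_rcons.
Qed.

Lemma td_go q i o t q' w d h : delta q (i 0) (t 0) = Some (q', w, d, h) ->
  iter (size w).+1 step (td_at q i o t) =
  td_at q' (write_move i (i 0, d)) (o ++ w) (write_move t h).
Proof.
move=> e; have hw := delta_bound e.
rewrite iterSr -td_write //; congr (iter _ _ _).
rewrite /step /tm_step /= val_insub_bseq //= e.
rewrite /td_config; congr MkConfig; apply: funext => -[||v] //=.
by rewrite write_moveE.
Qed.

(** The head is on the first letter of [l], which lists leftwards what remains to be crossed. It
    runs to the blank before the word and steps back right, as [outputs_within] fixes the head
    position. *)
Lemma td_rewind i t l r :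
  exists i' t', iter (size l).+1 step (td_config (inr false) i
      (ztape (behead (map Some l)) (ohead l :: map Some r)) t)
    = td_config (inr true) i' (wtape [::] (catrev l r)) t'.
Proof.
elim: l r => [|a l IH] r.
  exists i, t; rewrite /= /step /tm_step /=.
  rewrite /td_config; congr MkConfig; apply: funext => -[||v] /=; rewrite ?write_moveE //.
  by rewrite write_moveR; apply: funext => -[n|[|n]] //=; rewrite nth_nil.
have [i' [t' e]] := IH (a :: r).
exists i', t'; apply: etrans e; rewrite [LHS]iterSr; congr (iter _ _ _).
rewrite /step /tm_step /= /td_config; congr MkConfig.
apply: funext => -[||v] /=; rewrite ?write_moveE //.
by rewrite write_moveL; case: l {IH}.
Qed.

Lemma td_stop q i o t : delta q (i 0) (t 0) = None ->
  exists i' t', iter (size o).+2 step (td_at q i o t) =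
    td_config (inr true) i' (word_tape o) t'.
Proof.
move=> e; have [i' [t' eq]] := td_rewind i t (rev o) [::].
exists i', t'; rewrite word_tapeE -[X in wtape _ X]revK -/(catrev (rev o) [::]).
rewrite -eq size_rev [LHS]iterSr; congr (iter _ _ _).
rewrite /step /tm_step /= val_insub_bseq //= e.
rewrite /td_config; congr MkConfig; apply: funext => -[||v] /=; rewrite ?write_moveE //.
rewrite write_moveL /=; case: (rev o) => [|a l] /=; apply: funext => -[[|[|[|n]]]|n] //=.
Qed.

(** Time is counted in moves of [delta], each costing at most [bound.+1] machine steps: one per
    letter written and one to act. *)
Definition td_reach n c c' :=
  exists2 m, (m <= n * bound.+1)%N & iter m step c = c'.

Lemma td_reach0 c : td_reach 0 c c.
Proof. by exists 0%N. Qed.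

Lemma td_reach_mono n n' c c' : (n <= n')%N -> td_reach n c c' -> td_reach n' c c'.
Proof. by move=> le [m lem e]; exists m => //; rewrite (leq_trans lem) // leq_mul2r le orbT. Qed.

Lemma td_reach_trans n n' c c' c'' :
  td_reach n c c' -> td_reach n' c' c'' -> td_reach (n + n') c c''.
Proof.
move=> [m le <-] [m' le' <-]; exists (m' + m)%N; last by rewrite iterD.
by rewrite mulnDl addnC leq_add.
Qed.

Lemma td_reach1 q i o t q' w d h : delta q (i 0) (t 0) = Some (q', w, d, h) ->
  td_reach 1 (td_at q i o t)
    (td_at q' (write_move i (i 0, d)) (o ++ w) (write_move t h)).
Proof.
by move=> e; exists (size w).+1; [rewrite mul1n ltnS (delta_bound e)|apply: td_go].
Qed.

Lemma td_outputs w v q i t n :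
  td_reach n (td_at q0 (wtape [::] w) [::] (wtape [::] [::])) (td_at q i v t) ->
  delta q (i 0) (t 0) = None ->
  outputs_within td_tm w v (2 * (n * bound.+1) + 2)%N.
Proof.
move=> [m le e] stop.
have init : init_config td_tm w = td_at q0 (wtape [::] w) [::] (wtape [::] [::]).
  rewrite /init_config /td_at /td_config; congr MkConfig; apply: funext.
  by case=> [||v'] /=; rewrite -?blank_tapeE // map_id word_tapeE.
have [i' [t' e']] := td_stop v stop.
(* The cell at distance [m.+1] left of the head is still blank after [m] steps, so rewinding at most
   doubles the time. *)
have le' : (size v <= m)%N.
  rewrite leqNgt; apply/negP => lt.
  have := @run_support _ _ td_tm w OutTape m (Negz m).
  rewrite init -/step e /= -onthE => /(_ _ (leqnn _)) H.
  by have /(congr1 isSome) := H ltac:(by []); rewrite onthTE size_rev lt.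
apply: (@outputs_within_mono _ _ _ _ _ ((size v).+2 + m)%N); first lia.
rewrite /outputs_within init iterD -/step e e' /=; split=> // k.
by rewrite map_id.
Qed.

End Transducer.

(** * Letter-to-word substitutions in linear time *)

Lemma hom_polytime (S : finType) (h : S -> seq S) :
  exists (M : TM S S) c, forall w,
    outputs_within M w (flatten (map h w)) (c * size w ^ 1 + c).
Proof.
pose N := (\max_(s : S) size (h s))%N.
pose delta (q : unit) (a g : option S) :=
  if a is Some s then Some (tt, h s, MoveR, (g, MoveN)) else None.
have dN q a g q' w d h' : delta q a g = Some (q', w, d, h') -> (size w <= N)%N.
  by case: a => // s [_ <- _ _]; apply: leq_bigmax.
exists (td_tm N tt delta), (2 * N.+1 + 2)%N => w.
have run u v o : td_reach (q0 := tt) (delta := delta) (size v)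
    (td_at N tt delta tt (wtape u v) o (wtape [::] [::]))
    (td_at N tt delta tt (wtape (catrev v u) [::]) (o ++ flatten (map h v)) (wtape [::] [::])).
  elim: v u o => [|s v IH] u o; first by rewrite cats0; apply: td_reach0.
  rewrite -[size _]add1n /= catA; apply: td_reach_trans (IH (s :: u) _).
  have /= := @td_reach1 _ _ N tt delta dN tt (wtape u (s :: v)) o (wtape [::] [::]) _ _ _ _ erefl.
  by rewrite wtapeR write_moveE.
by apply: outputs_within_mono (td_outputs (run [::] w [::]) erefl); nia.
Qed.

(** * Constant terms and the symbols inside encodings *)

Lemma spoly_eval_const (R : realType) q (x : 'I_q -> R) c (p : spoly q) :
  spoly_eval x ((c, [::]) :: p) = ratr c + spoly_eval x p.
Proof.
rewrite /spoly_eval /mpoly_of big_cons /= big_nil rmorphD /= mevalD.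
by rewrite -mul_mpolyC mulr1 map_mpolyC mevalC.
Qed.

(** Adding a constant to a polynomial is prepending a term with empty monomial, so a machine only
    has to insert this word, without arithmetic. *)
Definition const_word (c : rat) := SPlus :: enc_rat c ++ [:: SMonEnd].

Lemma enc_spoly_const q c (p : spoly q) :
  enc_spoly ((c, [::]) :: p) = const_word c ++ enc_spoly p.
Proof. by rewrite /enc_spoly /= /enc_term /= -!catA. Qed.

(* Codes 0 to 6 are the symbols occurring inside numbers, monomials and
   polynomials. *)
Definition inner (s : symbol) := (symbol_code s < 7)%N.

(** The end marker occurs only at the end, so a machine can find the end of the number of
    variables. *)
Lemma enc_nat_rcons n :
  exists2 w, enc_nat n = rcons w SNumEnd & all (fun s => inner s && (s != SNumEnd)) w.
Proof.
rewrite /enc_nat; case: (bin_of_nat n) => [|p]; first by exists [::].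
by exists (pos_bits p); rewrite ?cats1 //; elim: p.
Qed.

Lemma enc_nat_inner n : all inner (enc_nat n).
Proof.
have [w -> h] := enc_nat_rcons n; rewrite all_rcons /=.
by apply: sub_all h => s /andP[].
Qed.

Lemma enc_rat_inner c : all inner (enc_rat c).
Proof.
by rewrite /enc_rat all_cat enc_nat_inner /enc_int all_cat enc_nat_inner; case: ifP.
Qed.

Lemma enc_seq_inner (T : Type) (item stop : symbol) (enc : T -> seq symbol) s :
  inner item -> (forall x, all inner (enc x)) ->
  exists2 w, enc_seq item stop enc s = rcons w stop & all inner w.
Proof.
move=> hi he; elim: s => [|x s [w e h]]; first by exists [::].
by exists (item :: enc x ++ w); rewrite /= ?e ?rcons_cat // hi all_cat he.
Qed.

Lemma enc_term_inner q (t : rat * monom q) : all inner (enc_term t).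
Proof.
rewrite /enc_term all_cat enc_rat_inner.
have [|v|w -> h] := @enc_seq_inner _ STimes SMonEnd (@enc_factor q) t.2 => //.
  by rewrite /enc_factor all_cat !enc_nat_inner.
by rewrite all_rcons h.
Qed.

(** A machine can thus cross a polynomial without parsing it: the first [SPolyEnd] closes it, and no
    comparison symbol occurs inside. *)
Lemma enc_spoly_inner q (p : spoly q) :
  exists2 w, enc_spoly p = rcons w SPolyEnd & all inner w.
Proof. by apply: enc_seq_inner => // t; apply: enc_term_inner. Qed.

(** * From eps-ETR to ETR *)

Section EpsToETR.
Variable eps : rat.

(** The relaxed comparison of [a] with [b] is the exact one of [a] with [b + eps_shift r]. *)
Definition eps_shift (r : eps_cmp) : rat :=
  match r with LtE | LeE => eps | GeE | GtE => - eps end.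

Definition cmp_of_eps (r : eps_cmp) : cmp :=
  match r with LtE => CLt | LeE => CLe | GeE => CGe | GtE => CGt end.

Fixpoint exact_formula q (F : eps_formula q) : formula q :=
  match F with
  | EAtom r p p' => FAtom (cmp_of_eps r) ((- eps_shift r, [::]) :: p) p'
  | EAnd F1 F2 => FAnd (exact_formula F1) (exact_formula F2)
  | EOr F1 F2 => FOr (exact_formula F1) (exact_formula F2)
  end.

Lemma holds_exact (R : realType) q (x : 'I_q -> R) (F : eps_formula q) :
  holds x (exact_formula F) <-> eps_holds (ratr eps) x F.
Proof.
elim: F => [r p p'|F1 IH1 F2 IH2|F1 IH1 F2 IH2] /=; rewrite ?IH1 ?IH2 //.
rewrite spoly_eval_const; case: r; rewrite /= ?opprK ?rmorphN /= addrC.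
- by rewrite ltrBlDr.
- by rewrite lerBlDr.
- by rewrite lerBlDr.
- by rewrite ltrBlDr.
Qed.

Definition eps_cmp_of_symbol (s : symbol) : option eps_cmp :=
  match s with
  | SLt => Some LtE | SLe => Some LeE | SGe => Some GeE | SGt => Some GtE
  | _ => None
  end.

Definition exact_word (s : symbol) : seq symbol :=
  s :: if eps_cmp_of_symbol s is Some r then const_word (- eps_shift r) else [::].

Lemma exact_word_inner w : all inner w -> flatten (map exact_word w) = w.
Proof.
elim: w => //= s w IH /andP[hs /IH ->].
by case: s hs.
Qed.

Lemma exact_word_spoly q (p : spoly q) :
  flatten (map exact_word (enc_spoly p)) = enc_spoly p.
Proof.
have [w -> h] := enc_spoly_inner p.
by rewrite map_rcons flatten_rcons exact_word_inner // cats1.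
Qed.

Lemma enc_exact q (F : eps_formula q) :
  flatten (map exact_word (enc_eps_formula F)) = enc_formula (exact_formula F).
Proof.
elim: F => [r p p'|F1 IH1 F2 IH2|F1 IH1 F2 IH2].
- rewrite -[RHS]/(_ :: enc_spoly ((_, _) :: _) ++ enc_spoly p') enc_spoly_const.
  by rewrite /= map_cat flatten_cat !exact_word_spoly -catA; case: r.
- by rewrite /= map_cat flatten_cat IH1 IH2.
- by rewrite /= map_cat flatten_cat IH1 IH2.
Qed.

Lemma eps_to_etr (R : realType) : polytime_reducible (EpsETR R eps) (ETR R).
Proof.
pose f (I : eps_etr_instance) : etr_instance :=
  existT formula (tag I) (exact_formula (tagged I)).
exists f; split; last first.
  by move=> [q F] /=; split=> -[x] h; exists x; apply/holds_exact.
have [M [c h]] := hom_polytime exact_word.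
exists M, c, 1%N => I /=.
suff -> : enc_etr (f I) = flatten (map exact_word (enc_eps_etr I)) by apply: h.
rewrite /enc_eps_etr map_cat flatten_cat enc_exact exact_word_inner //.
exact: enc_nat_inner.
Qed.

End EpsToETR.

(** * From ETR to eps-ETR *)

Inductive ctl :=
  | CNum | CForm of bool | CPoly of bool & option bool | CBack of bool
  | CPop | CPopped.

Definition ctls : seq ctl :=
  [:: CNum; CForm false; CForm true;
      CPoly false None; CPoly false (Some false); CPoly false (Some true);
      CPoly true None; CPoly true (Some false); CPoly true (Some true);
      CBack false; CBack true; CPop; CPopped].

Definition ctl_code (c : ctl) : nat :=
  match c with
  | CNum => 0
  | CForm b => 1 + b
  | CPoly b o => 3 + 3 * b + (if o is Some b' then 1 + b' else 0)
  | CBack b => 9 + b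
  | CPop => 11
  | CPopped => 12
  end%N.

Lemma ctl_codeK : pcancel ctl_code (onth ctls).
Proof. by do ![case=> //]. Qed.

HB.instance Definition _ := Countable.copy ctl (pcan_type ctl_codeK).

Lemma ctls_enum : Finite.axiom ctls.
Proof. by do ![case=> //]. Qed.

HB.instance Definition _ := isFinite.Build ctl ctls_enum.

Section ETRToEps.
Variable eps : rat.

(** * Negation normal form *)

Definition econn (neg : bool) q (F1 F2 : eps_formula q) :=
  if neg then EOr F1 F2 else EAnd F1 F2.

Definition conn_symbol (neg : bool) := if neg then SOr else SAnd.

(* Every atom, not only an equality, becomes a conjunction (a disjunction if
   it is negated) of two comparisons of the same polynomials: this makes the
   machine uniform. *)
Definition eps_cmps (neg : bool) (r : cmp) : eps_cmp * eps_cmp :=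
  match r with
  | CLt => if neg then (GeE, GeE) else (LtE, LtE)
  | CLe => if neg then (GtE, GtE) else (LeE, LeE)
  | CEq => if neg then (LtE, GtE) else (LeE, GeE)
  | CGe => if neg then (LtE, LtE) else (GeE, GeE)
  | CGt => if neg then (LeE, LeE) else (GtE, GtE)
  end.

Definition shift_atom q r (p p' : spoly q) :=
  EAtom r ((eps_shift eps r, [::]) :: p) p'.

Fixpoint nnf (neg : bool) q (F : formula q) : eps_formula q :=
  match F with
  | FAtom r p p' =>
    econn neg (shift_atom (eps_cmps neg r).1 p p')
              (shift_atom (eps_cmps neg r).2 p p')
  | FAnd F1 F2 => econn neg (nnf neg F1) (nnf neg F2)
  | FOr F1 F2 => econn (~~ neg) (nnf neg F1) (nnf neg F2)
  | FNot F1 => nnf (~~ neg) F1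
  end.

Lemma holds_shift_atom (R : realType) q (x : 'I_q -> R) r (p p' : spoly q) :
  eps_holds (ratr eps) x (shift_atom r p p') <->
  cmp_holds (cmp_of_eps r) (spoly_eval x p) (spoly_eval x p').
Proof.
rewrite /= spoly_eval_const addrC; case: r; rewrite /= ?rmorphN.
- by rewrite ltrD2r.
- by rewrite lerD2r.
- by rewrite lerD2r.
- by rewrite ltrD2r.
Qed.

Lemma holds_econn (R : realType) q (x : 'I_q -> R) neg (F1 F2 : eps_formula q) :
  eps_holds (ratr eps) x (econn neg F1 F2) <->
  if neg then eps_holds (ratr eps) x F1 \/ eps_holds (ratr eps) x F2
  else eps_holds (ratr eps) x F1 /\ eps_holds (ratr eps) x F2.
Proof. by case: neg. Qed.

(** The order is total: a negated inequality is the reverse one, and a negated equality is a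
    disjunction of two strict inequalities. *)
Lemma eps_cmps_holds (R : realType) neg r (a b : R) :
  (if neg then cmp_holds (cmp_of_eps (eps_cmps neg r).1) a b
               || cmp_holds (cmp_of_eps (eps_cmps neg r).2) a b
   else cmp_holds (cmp_of_eps (eps_cmps neg r).1) a b
        && cmp_holds (cmp_of_eps (eps_cmps neg r).2) a b) =
  neg (+) cmp_holds r a b.
Proof. by case: neg; case: r => /=; case: (ltgtP a b). Qed.

(** De Morgan's laws and double negation, used classically because [holds] takes values in
    [Prop]. *)
Lemma holds_nnf (R : realType) q (x : 'I_q -> R) neg (F : formula q) :
  eps_holds (ratr eps) x (nnf neg F) <-> if neg then ~ holds x F else holds x F.
Proof.
elim: F neg => [r p p'|F1 IH1 F2 IH2|F1 IH1 F2 IH2|F1 IH1] neg.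
- rewrite holds_econn; have := eps_cmps_holds neg r (spoly_eval x p) (spoly_eval x p').
  case: neg; rewrite !holds_shift_atom => e.
    by rewrite (rwP orP) e (rwP negP).
  by rewrite (rwP andP) e.
- by rewrite holds_econn; case: neg; rewrite IH1 IH2 //= not_andP.
- by rewrite holds_econn; case: neg; rewrite /= IH1 IH2 //= not_orP.
- by rewrite /= IH1; case: neg => //=; split=> [h|]; [apply|exact: contrapT].
Qed.

(** * The normalising transducer *)

Definition cmp_of_symbol (s : symbol) : option cmp :=
  match s with
  | SLt => Some CLt | SLe => Some CLe | SEq => Some CEq
  | SGe => Some CGe | SGt => Some CGt | _ => None
  end.

Definition atom_word (r : eps_cmp) := enc_eps_cmp r :: const_word (eps_shift eps r).

Definition bit (b : bool) := if b then SBit1 else SBit0.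

(* [CForm b] reads a formula under an odd (b) or even number of negations, and
   [CPoly snd pass] one of the polynomials of an atom; [CBack b] then returns
   to the comparison symbol for a second copy.  The stack holds the polarities
   of the pending right subformulas; its head is on the blank above the top. *)
Definition nnf_delta (q : ctl) (a g : option symbol) :
    option (ctl * seq symbol * direction * (option symbol * direction)) :=
  let keep := (g, MoveN) in
  match q, a with
  | CNum, Some s =>
    Some (if s == SNumEnd then CForm false else CNum, [:: s], MoveR, keep)
  | CForm b, Some s =>
    if cmp_of_symbol s is Some r then
      Some (CPoly false (Some b), conn_symbol b :: atom_word (eps_cmps b r).1,
            MoveR, keep)
    else match s with
    | SNot => Some (CForm (~~ b), [::], MoveR, keep)
    | SAnd => Some (CForm b, [:: conn_symbol b], MoveR, (Some (bit b), MoveR))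
    | SOr => Some (CForm b, [:: conn_symbol (~~ b)], MoveR, (Some (bit b), MoveR))
    | _ => None
    end
  | CPoly snd pass, Some s =>
    if s != SPolyEnd then Some (q, [:: s], MoveR, keep) else
    if ~~ snd then Some (CPoly true pass, [:: s], MoveR, keep) else
    if pass is Some b then Some (CBack b, [:: s], MoveN, keep)
    else Some (CPop, [:: s], MoveR, keep)
  | CBack b, Some s =>
    if cmp_of_symbol s is Some r then
      Some (CPoly false None, atom_word (eps_cmps b r).2, MoveR, keep)
    else Some (CBack b, [::], MoveL, keep)
  | CPop, _ => Some (CPopped, [::], MoveN, (g, MoveL))
  | CPopped, _ =>
    match g with
    | Some SBit0 => Some (CForm false, [::], MoveN, (None, MoveN))
    | Some SBit1 => Some (CForm true, [::], MoveN, (None, MoveN))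
    | _ => None
    end
  | _, None => None
  end.

(** The longest word written is a connective, a comparison symbol and one of the two constants. *)
Definition nnf_bound := (size (const_word eps) + size (const_word (- eps)) + 2)%N.

Lemma size_atom_word r : (size (atom_word r) < nnf_bound)%N.
Proof. by rewrite /nnf_bound; case: r; rewrite /atom_word /=; lia. Qed.

Lemma nnf_delta_bound q a g q' w d h :
  nnf_delta q a g = Some (q', w, d, h) -> (size w <= nnf_bound)%N.
Proof.
have b1 : (1 <= nnf_bound)%N by rewrite /nnf_bound addn2.
have b2 := size_atom_word.
case: q => [|b|snd pass|b||] /=.
- by case: a => // s [_ <- _ _].
- case: a => // s; case: (cmp_of_symbol s) => [r|]; first by case=> _ <- _ _; apply: b2.
  by case: s => // -[_ <- _ _].
- case: a => // s; case: ifP => _; first by case=> _ <- _ _.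
  by case: ifP => _; [|case: pass => [b|]]; case=> _ <- _ _.
- case: a => // s; case: (cmp_of_symbol s) => [r|] -[_ <- _ _] //.
  exact: ltnW.
- by case: a => [s|] [_ <- _ _].
- by case: a => [s'|]; case: g => [[]|] // [_ <- _ _].
Qed.

(** * Runs of the normalising transducer *)

Let reach := @td_reach _ _ nnf_bound CNum nnf_delta.
Let at_ q l r o st := td_at nnf_bound CNum nnf_delta q (wtape l r) o (wtape st [::]).

Lemma nnf_step q s l r o st q' w :
  nnf_delta q (Some s) None = Some (q', w, MoveR, (None, MoveN)) ->
  reach 1 (at_ q l (s :: r) o st) (at_ q' (s :: l) r (o ++ w) st).
Proof.
move=> e; have := @td_reach1 _ _ _ CNum _ nnf_delta_bound q (wtape l (s :: r)) o
  (wtape st [::]) q' w MoveR (None, MoveN) e.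
by rewrite wtapeR write_moveE.
Qed.

Lemma nnf_copy q w l r o st :
  {in w, forall s, nnf_delta q (Some s) None = Some (q, [:: s], MoveR, (None, MoveN))} ->
  reach (size w) (at_ q l (w ++ r) o st) (at_ q (catrev w l) r (o ++ w) st).
Proof.
elim: w l o => [|s w IH] l o h; first by rewrite cats0; apply: td_reach0.
rewrite -[size _]add1n -cat1s (catA o).
apply: td_reach_trans (IH (s :: l) _ _); last first.
  by move=> s' hs; apply: h; rewrite inE hs orbT.
by apply: nnf_step; apply: h; rewrite mem_head.
Qed.

(** The direction [d] stays free because the last letter of the first copy of an atom is left with
    [MoveN], ready for the way back. *)
Lemma nnf_copy_poly q (p : spoly q) snd pass q' d l r o st :
  nnf_delta (CPoly snd pass) (Some SPolyEnd) None =
    Some (q', [:: SPolyEnd], d, (None, MoveN)) ->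
  exists w, enc_spoly p = rcons w SPolyEnd /\
  all inner w /\
  reach (size (enc_spoly p)) (at_ (CPoly snd pass) l (enc_spoly p ++ r) o st)
    (td_at nnf_bound CNum nnf_delta q'
       (write_move (wtape (catrev w l) (SPolyEnd :: r)) (Some SPolyEnd, d))
       (o ++ enc_spoly p) (wtape st [::])).
Proof.
move=> e; have [w ep hw] := enc_spoly_inner p; exists w; do 2!split=> //.
rewrite ep size_rcons -addn1 cat_rcons -cats1 catA.
apply: td_reach_trans; first apply: nnf_copy.
  by move=> s /(allP hw); case: s.
have := @td_reach1 _ _ _ CNum _ nnf_delta_bound (CPoly snd pass)
  (wtape (catrev w l) (SPolyEnd :: r)) (o ++ w) (wtape st [::]) _ _ _ _ e.
by rewrite write_moveE.
Qed.

Lemma nnf_copy_polyR q (p : spoly q) snd pass q' l r o st :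
  nnf_delta (CPoly snd pass) (Some SPolyEnd) None =
    Some (q', [:: SPolyEnd], MoveR, (None, MoveN)) ->
  reach (size (enc_spoly p)) (at_ (CPoly snd pass) l (enc_spoly p ++ r) o st)
    (at_ q' (catrev (enc_spoly p) l) r (o ++ enc_spoly p) st).
Proof.
move=> e; have [w [ep [_]]] := nnf_copy_poly p l r o st e.
by rewrite wtapeR ep -cats1 catrev_catl.
Qed.

Definition no_cmp (s : symbol) := ~~ isSome (cmp_of_symbol s).

(** [CBack] moves left across every symbol that is not a comparison; [c] is the cell reached after
    [s] and all of [u]. *)
Lemma nnf_back b u s l r o st : all no_cmp (s :: u) -> forall c,
  reach (size u).+1 (at_ (CBack b) (u ++ c :: l) (s :: r) o st)
    (at_ (CBack b) l (c :: catrev u (s :: r)) o st).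
Proof.
elim: u s r => [|s' u IH] s r /andP[hs hu] c.
  have := @td_reach1 _ _ _ CNum _ nnf_delta_bound (CBack b)
    (wtape (c :: l) (s :: r)) o (wtape st [::]) (CBack b) [::] MoveL (None, MoveN).
  rewrite wtapeL write_moveE cats0; apply=> /=.
  by move: hs; rewrite /no_cmp; case: cmp_of_symbol.
rewrite -[(size _).+1]add1n; apply: td_reach_trans (IH s' (s :: r) hu c).
have := @td_reach1 _ _ _ CNum _ nnf_delta_bound (CBack b)
  (wtape (s' :: u ++ c :: l) (s :: r)) o (wtape st [::]) (CBack b) [::] MoveL (None, MoveN).
rewrite wtapeL write_moveE cats0; apply=> /=.
by move: hs; rewrite /no_cmp; case: cmp_of_symbol.
Qed.

Lemma nnf_pop b l r o st :
  reach 2 (at_ CPop l r o (bit b :: st)) (at_ (CForm b) l r o st).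
Proof.
apply: (@td_reach_trans _ _ _ _ _ 1 1).
  have := @td_reach1 _ _ _ CNum _ nnf_delta_bound CPop (wtape l r) o
    (wtape (bit b :: st) [::]) CPopped [::] MoveN (None, MoveL).
  by rewrite wtape_top; apply; case: r.
rewrite write_moveE cats0.
have := @td_reach1 _ _ _ CNum _ nnf_delta_bound CPopped (wtape l r) o
  (ztape (map Some st) [:: Some (bit b); None]) (CForm b) [::] MoveN (None, MoveN).
by rewrite wtape_pop write_moveE cats0; apply; case: b; case: r.
Qed.

Lemma enc_shift_atom q r (p p' : spoly q) :
  enc_eps_formula (shift_atom r p p') = atom_word r ++ enc_spoly p ++ enc_spoly p'.
Proof.
rewrite -[LHS]/(_ :: enc_spoly ((_, _) :: _) ++ enc_spoly p') enc_spoly_const.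
by rewrite -catA.
Qed.

Lemma enc_econn b q (F1 F2 : eps_formula q) :
  enc_eps_formula (econn b F1 F2) =
  conn_symbol b :: enc_eps_formula F1 ++ enc_eps_formula F2.
Proof. by case: b. Qed.

Lemma cmp_of_symbolK r : cmp_of_symbol (enc_cmp r) = Some r.
Proof. by case: r. Qed.

(** Three passes over the two polynomials, copy, return and copy again, explain the factor 3. *)
Lemma nnf_atom b q r (p p' : spoly q) l x o st :
  reach (3 * size (enc_formula (FAtom r p p')))
    (at_ (CForm b) l (enc_formula (FAtom r p p') ++ x) o st)
    (at_ CPop (catrev (enc_formula (FAtom r p p')) l) x
      (o ++ enc_eps_formula (nnf b (FAtom r p p'))) st).
Proof.
rewrite [enc_formula _]/= [enc_eps_formula _]enc_econn !enc_shift_atom.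
set A := enc_spoly p; set B := enc_spoly p'; set c := enc_cmp r.
set c1 := (eps_cmps b r).1; set c2 := (eps_cmps b r).2.
set o1 := o ++ conn_symbol b :: atom_word c1.
have s1 : reach 1 (at_ (CForm b) l (c :: A ++ B ++ x) o st)
    (at_ (CPoly false (Some b)) (c :: l) (A ++ B ++ x) o1 st).
  by apply: nnf_step; rewrite /= cmp_of_symbolK.
have s2 := @nnf_copy_polyR _ p false (Some b) _ (c :: l) (B ++ x) o1 st erefl.
have [w [eB [hw s3]]] := @nnf_copy_poly _ p' true (Some b) _ _
  (catrev A (c :: l)) x (o1 ++ A) st erefl.
have [v [eA hv]] := enc_spoly_inner p.
rewrite -/A -/B write_moveE in s2 s3 eA eB.
have no : all no_cmp (SPolyEnd :: rev (A ++ w)).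
  rewrite /= all_rev all_cat eA all_rcons /=.
  by apply/andP; split; [move: hv|move: hw]; apply: sub_all; case.
have s4 := nnf_back b l x ((o1 ++ A) ++ B) st no c.
(* The letters crossed on the way back form [A ++ B ++ x] again, so the second copy starts like the
   first. *)
rewrite -catrevE catrev_catl [catrev (rev _) _]catrevE revK -(catA A w) -(cat_rcons SPolyEnd w x) -eB in s4.
set o4 := (o1 ++ A) ++ B in s4.
have s5 : reach 1 (at_ (CBack b) l (c :: A ++ B ++ x) o4 st)
    (at_ (CPoly false None) (c :: l) (A ++ B ++ x) (o4 ++ atom_word c2) st).
  by apply: nnf_step; rewrite /= cmp_of_symbolK.
have s6 := @nnf_copy_polyR _ p false None _ (c :: l) (B ++ x)
  (o4 ++ atom_word c2) st erefl.
have s7 := @nnf_copy_polyR _ p' true None _ (catrev A (c :: l)) x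
  ((o4 ++ atom_word c2) ++ A) st erefl.
have := td_reach_trans s1 (td_reach_trans s2 (td_reach_trans s3
  (td_reach_trans s4 (td_reach_trans s5 (td_reach_trans s6 s7))))).
rewrite -/A -/B -catrev_catl /o4 /o1 -!catA /= -!catA.
apply: td_reach_mono.
rewrite size_rev !size_cat -/A -/B.
have -> : size B = (size w).+1 by rewrite eB size_rcons.
lia.
Qed.

(** The polarity pushed at the connective is popped between the two subformulas. One move to push
    and two to pop account exactly for the 3 allotted to [s]. *)
Lemma nnf_conn (s : symbol) (b d : bool) w1 w2 v1 v2 l x o st :
  nnf_delta (CForm b) (Some s) None =
    Some (CForm b, [:: conn_symbol d], MoveR, (Some (bit b), MoveR)) ->
  (forall l x o st, reach (3 * size w1) (at_ (CForm b) l (w1 ++ x) o st)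
    (at_ CPop (catrev w1 l) x (o ++ v1) st)) ->
  (forall l x o st, reach (3 * size w2) (at_ (CForm b) l (w2 ++ x) o st)
    (at_ CPop (catrev w2 l) x (o ++ v2) st)) ->
  reach (3 * size (s :: w1 ++ w2)) (at_ (CForm b) l (s :: (w1 ++ w2) ++ x) o st)
    (at_ CPop (catrev (s :: w1 ++ w2) l) x (o ++ conn_symbol d :: v1 ++ v2) st).
Proof.
move=> e h1 h2.
have := @td_reach1 _ _ _ CNum _ nnf_delta_bound (CForm b)
  (wtape l (s :: (w1 ++ w2) ++ x)) o (wtape st [::]) _ _ _ _ e.
rewrite wtapeR wtape_push -catA => s1.
have := td_reach_trans s1 (td_reach_trans (h1 _ _ _ _) (td_reach_trans (nnf_pop _ _ _ _ _) (h2 _ _ _ _))).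
rewrite -catrev_catl -!catA /=; apply: td_reach_mono.
by rewrite size_cat; lia.
Qed.

(** The invariant of the machine: a subformula is consumed exactly and the stack below is left
    intact, for an arbitrary rest of input [x] and stack [st]. *)
Lemma nnf_formula b q (F : formula q) l x o st :
  reach (3 * size (enc_formula F)) (at_ (CForm b) l (enc_formula F ++ x) o st)
    (at_ CPop (catrev (enc_formula F) l) x (o ++ enc_eps_formula (nnf b F)) st).
Proof.
elim: F b l x o st => [r p p'|F1 IH1 F2 IH2|F1 IH1 F2 IH2|F1 IH1] b l x o st.
- exact: nnf_atom.
- rewrite [enc_eps_formula _]enc_econn.
  exact: (@nnf_conn SAnd b b _ _ _ _ l x o st erefl (IH1 b) (IH2 b)).
- rewrite [enc_eps_formula _]enc_econn.
  exact: (@nnf_conn SOr b (~~ b) _ _ _ _ l x o st erefl (IH1 b) (IH2 b)).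
- rewrite [nnf _ _]/= [enc_formula _]/=.
  have := @nnf_step (CForm b) SNot l (enc_formula F1 ++ x) o st _ _ erefl.
  rewrite cats0 => s1.
  apply: td_reach_mono (td_reach_trans s1 (IH1 (~~ b) (SNot :: l) x o st)).
  by rewrite /= mulnS leq_add2r.
Qed.

Lemma nnf_init q (F : formula q) :
  reach (3 * size (enc_etr (existT _ q F)))
    (at_ CNum [::] (enc_etr (existT _ q F)) [::] [::])
    (at_ CPop (catrev (enc_etr (existT _ q F)) [::]) [::]
       (enc_eps_etr (existT _ q (nnf false F))) [::]).
Proof.
rewrite /enc_etr /enc_eps_etr /=; have [w -> h] := enc_nat_rcons q.
have hw : {in w, forall s,
    nnf_delta CNum (Some s) None = Some (CNum, [:: s], MoveR, (None, MoveN))}.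
  by move=> s /(allP h) /andP[_ ns]; rewrite /= (negPf ns).
have s1 := nnf_copy [::] (SNumEnd :: enc_formula F) [::] [::] hw.
have s2 : reach 1 (at_ CNum (catrev w [::]) (SNumEnd :: enc_formula F) w [::])
  (at_ (CForm false) (SNumEnd :: catrev w [::]) (enc_formula F) (w ++ [:: SNumEnd]) [::]).
  exact: nnf_step.
have s3 := nnf_formula false F (SNumEnd :: catrev w [::]) [::] (w ++ [:: SNumEnd]) [::].
rewrite cats0 in s3.
have := td_reach_trans s1 (td_reach_trans s2 s3).
rewrite !cat_rcons catrev_catl -catA /=.
apply: td_reach_mono.
rewrite size_cat /=; lia.
Qed.

Lemma etr_to_eps (R : realType) : polytime_reducible (ETR R) (EpsETR R eps).
Proof.
pose f (I : etr_instance) : eps_etr_instance :=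
  existT eps_formula (tag I) (nnf false (tagged I)).
exists f; split; last by move=> [q F] /=; split=> -[x] h; exists x; apply/(holds_nnf x false).
exists (td_tm nnf_bound CNum nnf_delta), (8 * nnf_bound.+1 + 2)%N, 1%N => -[q F].
have s1 := nnf_init F.
(* A last pop on the empty stack leads to [CPopped] on a blank, where [nnf_delta] stops. In all
   there are [3 * n + 1] moves for an input of length [n]. *)
have := @td_reach1 _ _ _ CNum _ nnf_delta_bound CPop
  (wtape (catrev (enc_etr (existT _ q F)) [::]) [::])
  (enc_eps_etr (existT _ q (nnf false F))) (wtape [::] [::]) _ _ _ _ erefl.
rewrite write_moveE cats0 blank_moveL => s2.
apply: outputs_within_mono (td_outputs (td_reach_trans s1 s2) erefl).
by rewrite -[encode _]/(enc_etr _) expn1; move: (size _) => n; nia.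
Qed.

End ETRToEps.

(** * Mutual reducibility and equality of the classes *)

Theorem theorem2 (R : realType) (eps : rat) (eps_ge0 : 0 <= eps) :
  (polytime_reducible (EpsETR R eps) (ETR R) /\
   polytime_reducible (ETR R) (EpsETR R eps)) /\
  (forall P : problem, class_of (EpsETR R eps) P <-> class_of (ETR R) P).
Proof.
have e1 := eps_to_etr eps R; have e2 := etr_to_eps eps R.
by split=> // P; split=> h; apply: polytime_reducible_trans h _.
Qed.
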